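(* Let $p$ be any prime and let $G$ be one of the groups $D_{2p}$, $D_{2p^2}$, $Q_{4p}$, $Q_{4p^2}$. Then: (a) $\mathcal{B}(G)$ is not integral, but it is L-integral, Q-integral and CN-integral. (b) $\mathcal{B}(G)$ is hypoenergetic, but it is not hyperenergetic, not L-hyperenergetic, not Q-hyperenergetic and not CN-hyperenergetic. (c) $\mathcal{B}(G)$ satisfies the E-LE conjecture, that is, $E(\mathcal{B}(G))\le LE(\mathcal{B}(G))$.
   Context: $D_{2m}=\langle a,b : a^m=b^2=1,\ bab=a^{-1}\rangle$ is the dihedral group of order $2m$ (for $m=2$ it is the group of order $4$ given by this presentation), and $Q_{4m}=\langle a,b : a^{2m}=1,\ b^2=a^m,\ bab^{-1}=a^{-1}\rangle$ is the dicyclic group of order $4m$. For a finite group $G$, let $L(G)$ be the set of all subgroups of $G$. The subgroup generating bipartite graph $\mathcal{B}(G)$ is the simple bipartite graph whose vertex set is partitioned into $G\times G$ and $L(G)$, in which $(a,b)\in G\times G$ and $H\in L(G)$ are adjacent if and only if $H$ is the subgroup generated by $a$ and $b$ (and there are no other edges). For a finite simple graph $\Gamma$ with vertices $v_1,\dots,v_n$ and $m$ edges, let $A$ be its adjacency matrix, $D$ its diagonal degree matrix, and $CN(\Gamma)$ its common neighborhood matrix, whose $(i,j)$ entry for $i\neq j$ is the number of vertices other than $v_i,v_j$ adjacent to both $v_i$ and $v_j$, and whose diagonal entries are zero. The graph $\Gamma$ is called integral, L-integral, Q-integral, CN-integral if all eigenvalues of $A$, $D-A$, $D+A$, $CN(\Gamma)$,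 respectively, are integers. With all sums over eigenvalues counted with multiplicity, the energy $E(\Gamma)$ is the sum of $|\alpha|$ over the eigenvalues $\alpha$ of $A$; the common neighborhood energy $E_{CN}(\Gamma)$ is the sum of $|\beta|$ over the eigenvalues $\beta$ of $CN(\Gamma)$; the Laplacian energy $LE(\Gamma)$ is the sum of $|\lambda-2m/n|$ over the eigenvalues $\lambda$ of $D-A$; and the signless Laplacian energy $LE^+(\Gamma)$ is the sum of $|\mu-2m/n|$ over the eigenvalues $\mu$ of $D+A$. Let $K_n$ be the complete graph on $n$ vertices; $E(K_n)=LE(K_n)=LE^+(K_n)=2(n-1)$ and $E_{CN}(K_n)=2(n-1)(n-2)$. A graph $\Gamma$ with $n$ vertices is called hypoenergetic if $E(\Gamma)<n$, hyperenergetic if $E(\Gamma)>E(K_n)$, L-hyperenergetic if $LE(\Gamma)>LE(K_n)$, Q-hyperenergetic if $LE^+(\Gamma)>LE^+(K_n)$, and CN-hyperenergetic if $E_{CN}(\Gamma)>E_{CN}(K_n)$. The E-LE conjecture (of Gutman et al., since disproved for graphs in general) is the assertion $E(\Gamma)\le LE(\Gamma)$. *)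

(* Defs.v *)
From HB Require Import structures.
From mathcomp Require Import all_boot all_order all_algebra all_fingroup.
From mathcomp Require Import all_field.

Set Implicit Arguments.
Unset Strict Implicit.
Unset Printing Implicit Defensive.

Import Order.TTheory GRing.Theory Num.Theory.

Section Presentations.

Local Open Scope group_scope.

(* For m > 0 both presentations define finite groups, so [\isog Grp] is        *)
(* isomorphism with the presented group itself. For m = 2 the first one is the *)
(* Klein four-group.                                                           *)

Definition is_dihedral (m : nat) (gT : finGroupType) : Prop :=
  [set: gT] \isog Grp (a : b : a ^+ m, b ^+ 2, b * a * b = a^-1).

Definition is_dicyclic (m : nat) (gT : finGroupType) : Prop :=
  [set: gT] \isog
    Grp (a : b : a ^+ (2 * m)%N, b ^+ 2 = a ^+ m, b * a * b^-1 = a^-1).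

End Presentations.

Record sgraph := SGraph {
  svertex :> finType;
  sadj : rel svertex;
  sadj_sym : symmetric sadj;
  sadj_irrefl : irreflexive sadj
}.

Section Spectra.

Local Open Scope ring_scope.

(* The list of roots of the characteristic polynomial, repeated according to   *)
(* multiplicity. All matrices below have integer entries, so that their        *)
(* complex eigenvalues lie in algC.                                            *)
Definition spectrum (n : nat) (A : 'M[algC]_n) : seq algC :=
  sval (closed_field_poly_normal (char_poly A)).

Lemma spectrumP (n : nat) (A : 'M[algC]_n) :
  char_poly A = \prod_(x <- spectrum A) ('X - x%:P).
Proof.
rewrite /spectrum; case: closed_field_poly_normal => s /= {1}->.
by rewrite (monicP (char_poly_monic A)) scale1r.
Qed.

Definition integral_mx (n : nat) (A : 'M[algC]_n) : Prop :=
  forall x : algC, eigenvalue A x -> x \is a Num.int.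

Definition num_edges (Gam : sgraph) : nat :=
  #|[set [set e.1; e.2] | e : Gam * Gam & sadj e.1 e.2]|.

Definition adjacency_mx (Gam : sgraph) : 'M[algC]_#|Gam| :=
  \matrix_(i, j) (sadj (enum_val i) (enum_val j))%:R.

Definition degree_mx (Gam : sgraph) : 'M[algC]_#|Gam| :=
  diag_mx (\row_i #|[set v : Gam | sadj (enum_val i) v]|%:R).

Definition laplacian_mx (Gam : sgraph) : 'M[algC]_#|Gam| :=
  degree_mx Gam - adjacency_mx Gam.

Definition signless_laplacian_mx (Gam : sgraph) : 'M[algC]_#|Gam| :=
  degree_mx Gam + adjacency_mx Gam.

Definition common_neighbors (Gam : sgraph) (u v : Gam) : {set Gam} :=
  [set w : Gam | [&& w != u, w != v, sadj w u & sadj w v]].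

Definition common_neighborhood_mx (Gam : sgraph) : 'M[algC]_#|Gam| :=
  \matrix_(i, j)
    if i == j then 0 else #|common_neighbors (enum_val i) (enum_val j)|%:R.

Definition integral_graph (Gam : sgraph) := integral_mx (adjacency_mx Gam).
Definition L_integral (Gam : sgraph) := integral_mx (laplacian_mx Gam).
Definition Q_integral (Gam : sgraph) :=
  integral_mx (signless_laplacian_mx Gam).
Definition CN_integral (Gam : sgraph) :=
  integral_mx (common_neighborhood_mx Gam).

(* The average degree 2m/n. *)
Definition avg_degree (Gam : sgraph) : algC :=
  (2 * num_edges Gam)%:R / #|Gam|%:R.

(* The energies are sums of absolute values, hence real elements of algC, on   *)
(* which the partial order of algC is the usual total order.                   *)

Definition energy (Gam : sgraph) : algC :=
  \sum_(x <- spectrum (adjacency_mx Gam)) `|x|.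

Definition CN_energy (Gam : sgraph) : algC :=
  \sum_(x <- spectrum (common_neighborhood_mx Gam)) `|x|.

Definition L_energy (Gam : sgraph) : algC :=
  \sum_(x <- spectrum (laplacian_mx Gam)) `|x - avg_degree Gam|.

Definition Q_energy (Gam : sgraph) : algC :=
  \sum_(x <- spectrum (signless_laplacian_mx Gam)) `|x - avg_degree Gam|.

End Spectra.

Section CompleteGraph.

Variable n : nat.

Definition complete_adj : rel 'I_n := fun i j => i != j.

Lemma complete_adj_sym : symmetric complete_adj.
Proof. by move=> i j; rewrite /complete_adj eq_sym. Qed.

Lemma complete_adj_irrefl : irreflexive complete_adj.
Proof. by move=> i; rewrite /complete_adj eqxx. Qed.

Definition complete_graph : sgraph :=
  SGraph complete_adj_sym complete_adj_irrefl.

End CompleteGraph.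

Section Energetic.

Local Open Scope ring_scope.

Definition hypoenergetic (Gam : sgraph) := energy Gam < #|Gam|%:R.

Definition hyperenergetic (Gam : sgraph) :=
  energy Gam > energy (complete_graph #|Gam|).

Definition L_hyperenergetic (Gam : sgraph) :=
  L_energy Gam > L_energy (complete_graph #|Gam|).

Definition Q_hyperenergetic (Gam : sgraph) :=
  Q_energy Gam > Q_energy (complete_graph #|Gam|).

Definition CN_hyperenergetic (Gam : sgraph) :=
  CN_energy Gam > CN_energy (complete_graph #|Gam|).

Definition satisfies_E_LE (Gam : sgraph) := energy Gam <= L_energy Gam.

End Energetic.

Section SubgroupGeneratingBipartiteGraph.

Variable gT : finGroupType.

(* [{group gT}] is the finite type of all subgroups of the group gT. *)
Definition sgb_adj : rel ((gT * gT) + {group gT}) := fun u v =>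
  match u, v with
  | inl (a, b), inr H | inr H, inl (a, b) => <<[set a; b]>>%g == H :> {set gT}
  | _, _ => false
  end.

Lemma sgb_adj_sym : symmetric sgb_adj.
Proof. by case=> [[a b]|H] [[c d]|K]. Qed.

Lemma sgb_adj_irrefl : irreflexive sgb_adj.
Proof. by case=> [[a b]|H]. Qed.

Definition subgroup_generating_graph : sgraph :=
  SGraph sgb_adj_sym sgb_adj_irrefl.

End SubgroupGeneratingBipartiteGraph.

(* Main.v *)
Require Import Defs.
From mathcomp Require Import all_boot all_order all_algebra all_fingroup.
From mathcomp Require Import all_field.
From mathcomp Require Import all_solvable ring zify.

(** A vertex (a, b) of the subgroup generating graph has exactly one neighbour,
    the subgroup generated by a and b. The graph is therefore a disjoint union
    of stars, one for each subgroup H, with as many leaves as there are pairs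
    generating H. More generally, a map f : X -> Y defines a star forest on
    X + Y in which x is a leaf of the star centred at f x. Its spectral data
    depend only on n = #|X|, l = #|Y| and the cardinals d y of the fibres of f:
    up to the multiplicities of 0, 1 and -1, the eigenvalues are plus and minus
    sqrt (d y) for the adjacency matrix, 0 and d y + 1 for the Laplacian and
    the signless Laplacian, and d y - 1 for the common neighborhood matrix
    ([perm_spectrum_adjacency], [perm_spectrum_degree_adjacency],
    [perm_spectrum_CN]). All of them follow from one characteristic polynomial,
    computed by block elimination in [det_star_block].

    The last three matrices are thus integral. The graph is hypoenergetic
    because 2 sqrt d <= d + 1, and the fibres and centres together account for
    all n + l vertices. Let k be the number of empty fibres. Multiplying the
    Laplacian energy by n + l clears the denominator of the average degree and
    gives the integer
      (n + l)^2 + (n - l) |n - l| + k (|n - l| + n - l)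
    ([sum_norm_sub_avg]), from which the comparisons with the energy of the
    graph and with the complete graph are elementary inequalities
    ([deviation_bounds]). The common neighborhood energy is at most 2 n.

    Non-integrality, and strictness in the first inequality, need a single
    fibre whose cardinal is not a square. In a nontrivial group, a subgroup of
    prime order q is generated by all its pairs but the trivial one, and
    q^2 - 1 is not a square. Finally, both presentations have the group
    of order 2 as a quotient, by sending a to 1, so the groups are nontrivial. *)

Set Implicit Arguments.
Unset Strict Implicit.
Unset Printing Implicit Defensive.

Import Order.TTheory GRing.Theory Num.Theory.

(** * Determinants of bordered Gram matrices *)

Section BlockDeterminants.

Local Open Scope ring_scope.

Variables (R : comNzRingType) (n l : nat) (B : 'M[R]_(n, l)) (d : 'rV[R]_l).
Hypothesis BtB : B^T *m B = diag_mx d.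

(** Both sides are the determinant of the block matrix with rows (a, B) and
    (b B^T, 1), computed by eliminating either of the off-diagonal blocks. *)
Lemma det_scalar_sub_gram a b :
  \det (a%:M - b *: (B *m B^T)) * a ^+ l
  = a ^+ n * \prod_j (a - b * d 0 j).
Proof.
pose P := block_mx a%:M B (b *: B^T) 1%:M.
have elimL : P *m block_mx 1%:M 0 (- (b *: B^T)) 1%:M
             = block_mx (a%:M - b *: (B *m B^T)) B 0 1%:M.
  rewrite mulmx_block !mulmx1 !mul1mx !mulmx0 !add0r mulmxN -scalemxAr.
  by rewrite subrr.
have elimU : P *m block_mx 1%:M (- B) 0 a%:M
             = block_mx a%:M 0 (b *: B^T) (diag_mx (\row_j (a - b * d 0 j))).
  rewrite mulmx_block !mulmx1 !mul1mx !mulmx0 !addr0 !mulmxN mul_scalar_mx.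
  rewrite mul_mx_scalar addNr -scalemxAl BtB; congr block_mx.
  by apply/matrixP=> i j; rewrite !mxE mulrnBl mulrnAr addrC.
move/(congr1 determinant): elimL; move/(congr1 determinant): elimU.
rewrite !det_mulmx !det_ublock !det_lblock !det1 !mul1r !mulr1 !det_scalar.
rewrite det_diag => + <- => ->; congr (_ * _).
by apply: eq_bigr => j _; rewrite mxE.
Qed.

(** The Gram matrix acts on the columns of B by the scalars d, hence so does
    its affine image A = a - b B B^T. The block c B can then be cancelled by
    column operations that multiply the last l columns by a - b d. *)
Lemma det_star_block a b c (e : 'rV[R]_l) :
  \det (block_mx (a%:M - b *: (B *m B^T)) (c *: B) (c *: B^T) (diag_mx e))
    * \prod_j (a - b * d 0 j)
  = \det (a%:M - b *: (B *m B^T))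
    * \prod_j (e 0 j * (a - b * d 0 j) - c ^+ 2 * d 0 j).
Proof.
pose s := \row_j (a - b * d 0 j).
pose t := \row_j (e 0 j * (a - b * d 0 j) - c ^+ 2 * d 0 j).
set A := a%:M - _.
have AB : A *m B = B *m diag_mx s.
  rewrite mulmxBl mul_scalar_mx -scalemxAl -mulmxA BtB !mul_mx_diag.
  by apply/matrixP=> i j; rewrite !mxE; ring.
have elim : block_mx A (c *: B) (c *: B^T) (diag_mx e)
              *m block_mx 1%:M (- (c *: B)) 0 (diag_mx s)
            = block_mx A 0 (c *: B^T) (diag_mx t).
  rewrite mulmx_block !mulmx1 !mulmx0 !addr0 mulmxN -scalemxAr AB -scalemxAl.
  rewrite addNr mulmxN -scalemxAl -scalemxAr BtB; congr block_mx.
  rewrite mul_mx_diag; apply/matrixP=> i j; rewrite !mxE.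
  by case: eqVneq => [->|_]; rewrite ?mulr1n ?mulr0n; ring.
move/(congr1 determinant): elim.
rewrite det_mulmx det_ublock det_lblock det1 mul1r !det_diag.
do 2!rewrite (eq_bigr _ (fun j _ => mxE _ _ _ _)).
by [].
Qed.

End BlockDeterminants.

(** * Spectra from characteristic polynomials *)

Section Spectra.

Local Open Scope ring_scope.

Lemma det_reindex (R : comNzRingType) (m n : nat) (h : 'I_m -> 'I_n)
    (A : 'M[R]_n) :
  bijective h -> \det (\matrix_(i, j) A (h i) (h j)) = \det A.
Proof.
move=> bij_h; have mn : m = n by have := bij_eq_card bij_h; rewrite !card_ord.
subst n; pose s := perm (bij_inj bij_h).
have -> : \matrix_(i, j) A (h i) (h j) = row_perm s (col_perm s A).
  by apply/matrixP=> i j; rewrite !mxE !permE.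
rewrite row_permE col_permE !det_mulmx !det_perm mulrCA odd_permV -expr2.
by rewrite sqrr_sign mulr1.
Qed.

Lemma det_sum_index (R : comNzRingType) (X Y : finType)
    (F : X + Y -> X + Y -> R) :
  \det (\matrix_(i < #|{: X + Y}|, j < #|{: X + Y}|)
          F (enum_val i) (enum_val j))
  = \det (block_mx
      (\matrix_(i, j) F (inl (enum_val i)) (inl (enum_val j)))
      (\matrix_(i, j) F (inl (enum_val i)) (inr (enum_val j)))
      (\matrix_(i, j) F (inr (enum_val i)) (inl (enum_val j)))
      (\matrix_(i, j) F (inr (enum_val i)) (inr (enum_val j)))
      : 'M_(#|X| + #|Y|)).
Proof.
pose w (i : 'I_(#|X| + #|Y|)) : X + Y :=
  match split i with inl j => inl (enum_val j) | inr j => inr (enum_val j) end.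
pose w' (u : X + Y) : 'I_(#|X| + #|Y|) :=
  unsplit (match u with inl x => inl (enum_rank x)
                      | inr y => inr (enum_rank y) end).
have bij_h : bijective (fun i => enum_rank (w i)).
  exists (fun j => w' (enum_val j)) => [i|j].
    rewrite enum_rankK /w /w' -[RHS]splitK.
    by case: (split i) => k; rewrite enum_valK.
  rewrite -[RHS]enum_valK; congr enum_rank; rewrite /w /w' unsplitK.
  by case: (enum_val j) => k; rewrite enum_rankK.
rewrite -(det_reindex _ bij_h); congr determinant; apply/matrixP=> i j.
rewrite !mxE !enum_rankK /w.
by case: (split i) => i'; rewrite mxE; case: (split j) => j'; rewrite ?mxE.
Qed.

(** The auxiliary list s allows for identities in which the characteristic
    polynomial is known only after multiplication by some linear factors, as
    in the determinants above. *)
Lemma perm_spectrum (n : nat) (A : 'M[algC]_n) (s t : seq algC) :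
  char_poly A * \prod_(x <- s) ('X - x%:P) = \prod_(x <- t) ('X - x%:P) ->
  perm_eq (spectrum A ++ s) t.
Proof. by rewrite spectrumP -big_cat; apply: prod_XsubC_eq. Qed.

Lemma eigenvalue_spectrum (n : nat) (A : 'M[algC]_n) (x : algC) :
  eigenvalue A x = (x \in spectrum A).
Proof. by rewrite eigenvalue_root_char spectrumP root_prod_XsubC. Qed.

Lemma integral_mx_perm (m : nat) (A : 'M[algC]_m) (s t : seq algC) :
  perm_eq (spectrum A ++ s) t -> {subset t <= Num.int} -> integral_mx A.
Proof.
move=> eq_st int_t x; rewrite eigenvalue_spectrum => sx; apply: int_t.
by rewrite -(perm_mem eq_st) mem_cat sx.
Qed.

Lemma prod_XsubC_nseq (m : nat) (a : algC) :
  \prod_(x <- nseq m a) ('X - x%:P) = ('X - a%:P) ^+ m.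
Proof. by rewrite big_nseq -Monoid.iteropE. Qed.

Lemma sum_nseq (V : nmodType) (T : Type) (m : nat) (a : T) (g : T -> V) :
  \sum_(x <- nseq m a) g x = g a *+ m.
Proof. by rewrite big_nseq -Monoid.iteropE. Qed.

Section StarSpectrum.

Variables (X Y : finType) (f : X -> Y) (a b c : algC) (e : Y -> algC).

Definition fiber (y : Y) : {set X} := [set x | f x == y].

(** With suitable coefficients, this gives the adjacency, Laplacian, signless
    Laplacian and common neighborhood matrices of the star forest of f. *)
Definition star_entry (u v : X + Y) : algC :=
  match u, v with
  | inl x, inl x' => a *+ (x == x') + b *+ (f x == f x')
  | inl x, inr y | inr y, inl x => c *+ (f x == y)
  | inr y, inr y' => e y *+ (y == y')
  end.

Definition incidence (R : nzRingType) : 'M[R]_(#|X|, #|Y|) :=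
  \matrix_(i, j) (f (enum_val i) == enum_val j)%:R.

Lemma incidence_gram (R : nzRingType) :
  (incidence R)^T *m incidence R = diag_mx (\row_j #|fiber (enum_val j)|%:R).
Proof.
apply/matrixP=> i j; rewrite !mxE.
transitivity (\sum_(x : X) ((f x == enum_val i) && (f x == enum_val j))%:R : R).
  rewrite (reindex (@enum_val X predT)) /=; last first.
    by apply: onW_bij; apply: enum_val_bij.
  by apply: eq_bigr => k _; rewrite !mxE -natrM mulnb.
case: eqVneq => [<-|neq_ij].
  rewrite mulr1n /fiber -sum1_card natr_sum [RHS]big_mkcond /=.
  by apply: eq_bigr => x _; rewrite inE andbb; case: (_ == _).
rewrite mulr0n big1 // => x _; case: (f x =P _) => //= ->.
by rewrite (inj_eq enum_val_inj) (negPf neq_ij).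
Qed.

Lemma incidence_cogram (R : nzRingType) :
  incidence R *m (incidence R)^T
  = \matrix_(i, j) (f (enum_val i) == f (enum_val j))%:R.
Proof.
apply/matrixP=> i j; rewrite !mxE.
rewrite (bigD1 (enum_rank (f (enum_val i)))) //= !mxE enum_rankK eqxx mul1r.
rewrite big1 ?addr0 1?eq_sym // => k; rewrite !mxE => neq_k.
rewrite [_ == enum_val k]eq_sym -(inj_eq enum_rank_inj) enum_valK.
by rewrite (negPf neq_k) mul0r.
Qed.

Lemma perm_spectrum_class_mx (A : 'M[algC]_#|X|) :
  A = \matrix_(i, j) (a *+ (enum_val i == enum_val j)
                      + b *+ (f (enum_val i) == f (enum_val j))) ->
  perm_eq (spectrum A ++ nseq #|Y| a)
          (nseq #|X| a ++ [seq a + b * #|fiber y|%:R | y <- enum Y]).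
Proof.
move=> AE; apply: perm_spectrum; rewrite big_cat !prod_XsubC_nseq /=.
have := det_scalar_sub_gram (incidence_gram _) ('X - a%:P) b%:P.
rewrite incidence_cogram big_map big_enum /=.
have -> : ('X - a%:P)%:M - b%:P *: (\matrix_(i, j)
    (f (enum_val i) == f (enum_val j))%:R) = char_poly_mx A.
  apply/matrixP=> i j; rewrite AE !mxE (inj_eq enum_val_inj).
  by case: (i == j); case: (_ == _); rewrite /= ?polyCD ?rmorph0; ring.
rewrite -/(char_poly A) => ->; congr (_ * _).
rewrite [RHS](reindex (@enum_val Y predT)) /=; last first.
  by apply: onW_bij; apply: enum_val_bij.
apply: eq_bigr => j _; rewrite !mxE.
by rewrite polyCD polyCM rmorph_nat opprD addrA.
Qed.

(** Each y contributes the roots u y and v y of the quadratic polynomial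
    (X - e y) (X - a - b d y) - c^2 d y, given here by their sum and product. *)
Lemma perm_spectrum_star_mx (A : 'M[algC]_#|{: X + Y}|) (u v : Y -> algC) :
  A = \matrix_(i, j) star_entry (enum_val i) (enum_val j) ->
  (forall y, u y + v y = e y + (a + b * #|fiber y|%:R)) ->
  (forall y, u y * v y
             = e y * (a + b * #|fiber y|%:R) - c ^+ 2 * #|fiber y|%:R) ->
  perm_eq (spectrum A ++ nseq #|Y| a)
          (nseq #|X| a ++ map u (enum Y) ++ map v (enum Y)).
Proof.
move=> AE uDv uMv; apply: perm_spectrum.
rewrite !big_cat !prod_XsubC_nseq 2!big_map 2!big_enum /= -big_split /=.
pose B := incidence {poly algC}; pose a' := 'X - a%:P.
pose d : 'rV[{poly algC}]_#|Y| := \row_j #|fiber (enum_val j)|%:R.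
pose e' : 'rV[{poly algC}]_#|Y| := \row_j ('X - (e (enum_val j))%:P).
have BtB : B^T *m B = diag_mx d by apply: incidence_gram.
have charA : char_poly A
    = \det (block_mx (a'%:M - b%:P *: (B *m B^T)) ((- c%:P) *: B)
                     ((- c%:P) *: B^T) (diag_mx e')).
  pose F (s t : X + Y) := 'X *+ (s == t) - (star_entry s t)%:P.
  rewrite /char_poly -[RHS](_ :
    \det (\matrix_(i < #|{: X + Y}|, j < #|{: X + Y}|)
            F (enum_val i) (enum_val j)) = _).
    congr determinant; apply/matrixP=> i j.
    by rewrite !mxE /F (inj_eq enum_val_inj) AE mxE.
  rewrite det_sum_index /F; congr (\det (block_mx _ _ _ _)).
  - rewrite incidence_cogram; apply/matrixP=> i j.
    rewrite !mxE /a' /= (inj_eq enum_val_inj) (inj_eq inl_inj).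
    rewrite (inj_eq enum_val_inj).
    by case: (i == j); case: (_ == _); rewrite /= ?polyCD ?rmorph0; ring.
  - apply/matrixP=> i j; rewrite !mxE /=.
    by case: (_ == _); rewrite /= ?rmorph0; ring.
  - apply/matrixP=> i j; rewrite !mxE /=.
    by case: (_ == _); rewrite /= ?rmorph0; ring.
  - apply/matrixP=> i j; rewrite !mxE /= (inj_eq inr_inj).
    rewrite (inj_eq enum_val_inj); case: eqVneq => [->|_]; first by [].
    by rewrite /= rmorph0 subr0.
(* This product is the superfluous common factor of the two determinant
   identities. *)
have q_neq0 : \prod_j (a' - b%:P * d 0 j) != 0.
  apply/prodf_neq0 => j _; rewrite mxE -(rmorph_nat polyC) -rmorphM /a' /=.
  by rewrite -addrA -opprD -polyCD polyXsubC_eq0.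
apply: (mulIf q_neq0); rewrite -/a' mulrAC charA (det_star_block BtB).
rewrite mulrAC (det_scalar_sub_gram BtB) mulrAC; congr (_ * _ * _).
rewrite [RHS](reindex (@enum_val Y predT)) /=; last first.
  by apply: onW_bij; apply: enum_val_bij.
apply: eq_bigr => j _; rewrite !mxE /a'; set y := enum_val j.
set k : algC := #|fiber y|%:R.
have -> : #|fiber y|%:R = k%:P :> {poly algC} by rewrite /k (rmorph_nat polyC).
have {}uDv : (u y)%:P + (v y)%:P = (e y)%:P + (a%:P + b%:P * k%:P).
  by rewrite -polyCD uDv !polyCD polyCM.
have {}uMv : (u y)%:P * (v y)%:P
    = (e y)%:P * (a%:P + b%:P * k%:P) - c%:P ^+ 2 * k%:P.
  by rewrite -polyCM uMv polyCB !polyCM polyCD polyCM expr2.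
transitivity ('X ^+ 2 - ((u y)%:P + (v y)%:P) * 'X + (u y)%:P * (v y)%:P).
  by rewrite uDv uMv; ring.
by ring.
Qed.

End StarSpectrum.

Lemma sum_spectrum_star (Y : finType) (s : seq algC) (n : nat) (a : algC)
    (u v : Y -> algC) (g : algC -> algC) :
  perm_eq (s ++ nseq #|Y| a) (nseq n a ++ map u (enum Y) ++ map v (enum Y)) ->
  \sum_(x <- s) g x + g a *+ #|Y|
  = g a *+ n + \sum_y (g (u y) + g (v y)).
Proof.
move=> eq_s; rewrite -(sum_nseq #|Y|) -(sum_nseq n) -big_cat.
rewrite (perm_big _ eq_s) !big_cat /=.
by rewrite 2!big_map 2!big_enum /= -big_split.
Qed.

End Spectra.

(** * Energies of complete graphs *)

Section CompleteGraph.

Local Open Scope ring_scope.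

Variable m : nat.
Local Notation K := (complete_graph m.+1).

(** Such a matrix is a + b J for the all-ones matrix J, which is the Gram
    matrix of the incidence matrix of a constant map. *)
Lemma sum_spectrum_two_values (a b : algC) (g : algC -> algC)
    (A : 'M[algC]_#|'I_m.+1|) :
  A = \matrix_(i, j) (if i == j then a + b else b) ->
  \sum_(x <- spectrum A) g x = g a *+ m + g (a + b * m.+1%:R).
Proof.
move=> AE; pose f (i : 'I_m.+1) := tt.
have eq_s : perm_eq (spectrum A ++ nseq #|{: unit}| a)
    (nseq #|'I_m.+1| a ++ [seq a + b * #|fiber f y|%:R | y <- enum {: unit}]).
  apply: perm_spectrum_class_mx; rewrite AE; apply/matrixP=> i j.
  by rewrite !mxE (inj_eq enum_val_inj); case: (i == j); rewrite ?add0r.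
have fib : #|fiber f tt| = m.+1.
  by apply: etrans (card_ord m.+1); apply: eq_card => i; rewrite inE.
apply: (addIr (g a *+ #|{: unit}|)); rewrite -[in LHS]sum_nseq -big_cat.
rewrite (perm_big _ eq_s) big_cat sum_nseq big_map big_enum card_ord card_unit.
by rewrite (big_pred1 tt) => [|[]] //=; rewrite fib mulrSr addrAC.
Qed.

Lemma degree_complete (i : 'I_m.+1) : #|[set v : K | i != v]| = m.
Proof.
transitivity #|[set~ i]|; last by rewrite cardsC1 card_ord.
by apply: eq_card => v; rewrite !inE eq_sym.
Qed.

Lemma card_common_neighbors_complete (u v : K) :
  u != v -> #|common_neighbors u v| = m.-1.
Proof.
move=> neq_uv; transitivity #|~: [set u; v]|.
  apply: eq_card => w; rewrite !inE /= /complete_adj negb_or.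
  by case: (w != u); case: (w != v).
by rewrite cardsCs setCK cards2 neq_uv card_ord subSS subn1.
Qed.

Lemma avg_degree_complete : avg_degree K = m%:R.
Proof.
have edgesE : num_edges K = 'C(#|'I_m.+1|, 2).
  rewrite -card_draws /num_edges.
  congr #|pred_of_set _|; apply/setP=> A; rewrite inE.
  apply/imsetP/cards2P => [[[i j]]|[i [j [ij ->]]]].
    by rewrite inE => /= ij ->; exists i, j.
  by exists (i, j); rewrite ?inE.
rewrite /avg_degree edgesE mul2n !card_ord.
have -> : ('C(m.+1, 2)).*2 = (m * m.+1)%N.
  by rewrite bin2 -[RHS](odd_double_half (m * m.+1)) oddM /= andbN mulnC.
by rewrite natrM mulfK // pnatr_eq0.
Qed.

Lemma energy_complete : energy K = (2 * m)%:R.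
Proof.
rewrite /energy (@sum_spectrum_two_values (-1) 1); last first.
  apply/matrixP=> i j; rewrite !mxE /= /complete_adj (inj_eq enum_val_inj).
  by case: eqP => _ //=; rewrite addNr.
rewrite normrN1 mul1r -natr1 addrCA addNr addr0 normr_nat.
by rewrite -natrD mul2n addnn.
Qed.

Lemma L_energy_complete : L_energy K = (2 * m)%:R.
Proof.
rewrite /L_energy avg_degree_complete.
rewrite (@sum_spectrum_two_values m.+1%:R (-1)); last first.
  apply/matrixP=> i j; rewrite !mxE /= /complete_adj (inj_eq enum_val_inj).
  rewrite degree_complete; case: eqP => _ /=; last by rewrite sub0r.
  by rewrite subr0 -natr1 addrK.
rewrite mulN1r subrr sub0r normrN normr_nat -natr1 addrAC subrr add0r normr1.
by rewrite -natrD mul2n addnn.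
Qed.

Lemma Q_energy_complete : Q_energy K = (2 * m)%:R.
Proof.
rewrite /Q_energy avg_degree_complete.
rewrite (@sum_spectrum_two_values (m%:R - 1) 1); last first.
  apply/matrixP=> i j; rewrite !mxE /= /complete_adj (inj_eq enum_val_inj).
  rewrite degree_complete; case: eqP => _ /=; last by rewrite add0r.
  by rewrite addr0 subrK.
rewrite addrAC subrr sub0r normrN1 mul1r -natr1.
have -> : m%:R - 1 + (m%:R + 1) - m%:R = m%:R :> algC by ring.
by rewrite normr_nat -natrD mul2n addnn.
Qed.

Lemma CN_energy_complete : CN_energy K = (2 * (m * m.-1))%:R.
Proof.
rewrite /CN_energy (@sum_spectrum_two_values (- m.-1%:R) m.-1%:R); last first.
  apply/matrixP=> i j; rewrite !mxE; case: eqVneq => [_|neq_ij].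
    by rewrite addNr.
  by rewrite card_common_neighbors_complete ?(inj_eq enum_val_inj).
rewrite normrN normr_nat.
have -> : - m.-1%:R + m.-1%:R * m.+1%:R = (m * m.-1)%:R :> algC.
  by rewrite -natr1 natrM; ring.
by rewrite normr_nat -mulrnA -natrD mulnC addnn mul2n.
Qed.

End CompleteGraph.
(** * Spectra and energies of star forests *)

Section StarForest.

Local Open Scope ring_scope.

Variables (X Y : finType) (f : X -> Y).

Definition star_adj (u v : X + Y) : bool :=
  match u, v with
  | inl x, inr y | inr y, inl x => f x == y
  | _, _ => false
  end.

(* The relation is only assumed to agree pointwise with star_adj, so that the
   results apply to graphs whose adjacency is presented differently. *)
Variables (adj : rel (X + Y)) (adj_sym : symmetric adj)
  (adj_irrefl : irreflexive adj).
Hypothesis adjE : adj =2 star_adj.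

Let Gam := SGraph adj_sym adj_irrefl.
Local Notation n := #|X|.
Local Notation l := #|Y|.
Local Notation d y := #|fiber f y|.

Lemma num_edges_star_forest : num_edges Gam = n.
Proof.
pose edge x : {set Gam} := [set inl x; inr (f x)].
rewrite /num_edges -[RHS](card_imset _ (f := edge)); last first.
  move=> x x' eq_xx'; have: (inl x : Gam) \in edge x' by rewrite -eq_xx' set21.
  by rewrite !inE orbF => /eqP[].
congr #|pred_of_set _|; apply/setP=> A; apply/imsetP/imsetP => [] [].
  move=> [[x|y] [x'|y']]; rewrite !inE /= adjE //= => /eqP <- ->.
    by exists x.
  by exists x'; rewrite // setUC.
by move=> x _ ->; exists (inl x, inr (f x)); rewrite // inE /= adjE /=.
Qed.

Lemma card_star_forest : #|Gam| = (n + l)%N.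
Proof. exact: card_sum. Qed.

Lemma degree_star_leaf x : #|[set v : Gam | adj (inl x) v]| = 1%N.
Proof.
rewrite -(cards1 (inr (f x) : Gam)); congr #|pred_of_set _|.
apply/setP=> [[x'|y]]; rewrite !inE adjE //=.
by rewrite (inj_eq inr_inj) eq_sym.
Qed.

Lemma degree_star_center y : #|[set v : Gam | adj (inr y) v]| = d y.
Proof.
rewrite -(card_imset _ (@inl_inj X Y)); congr #|pred_of_set _|.
apply/setP=> [[x|y']]; rewrite !inE adjE //=.
  by rewrite mem_imset ?inE //; apply: inl_inj.
by symmetry; apply/imsetP=> [[]].
Qed.

Lemma perm_spectrum_adjacency :
  perm_eq (spectrum (adjacency_mx Gam) ++ nseq l 0)
          (nseq n 0 ++ [seq sqrtC (d y)%:R | y <- enum Y]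
                    ++ [seq - sqrtC (d y)%:R | y <- enum Y]).
Proof.
apply: (@perm_spectrum_star_mx _ _ f 0 0 1 (fun=> 0)) => [|y|y].
- apply/matrixP=> i j; rewrite !mxE /= adjE.
  case: (enum_val i) (enum_val j) => [x|y] [x'|y'] /=;
  by rewrite ?mul0rn ?addr0.
- by rewrite subrr /=; ring.
- by rewrite mulrN -expr2 sqrtCK /=; ring.
Qed.

(** For c = -1 and c = 1 these are the Laplacian and the signless Laplacian,
    which are cospectral since the forest is bipartite. *)
Lemma perm_spectrum_degree_adjacency (A : 'M[algC]_#|Gam|) (c : algC) :
  c ^+ 2 = 1 -> A = degree_mx Gam + c *: adjacency_mx Gam ->
  perm_eq (spectrum A ++ nseq l 1)
          (nseq n 1 ++ [seq 0 | y <- enum Y]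
                    ++ [seq (d y)%:R + 1 | y <- enum Y]).
Proof.
move=> c2 ->.
apply: (@perm_spectrum_star_mx _ _ f 1 0 c (fun y => (d y)%:R)) => [|y|y].
- apply/matrixP=> i j; rewrite !mxE /= adjE.
  rewrite -(inj_eq enum_val_inj).
  case: (enum_val i) (enum_val j) => [x|y] [x'|y'] /=.
  - by rewrite degree_star_leaf mulr0 mul0rn.
  - by rewrite mulr0n add0r mulr_natr.
  - by rewrite mulr0n add0r mulr_natr.
  - by rewrite degree_star_center mulr0 addr0.
- by ring.
- by rewrite c2; ring.
Qed.

Lemma card_common_neighbors_star (u v : Gam) : u != v ->
  #|common_neighbors u v|
  = match u, v with inl x, inl x' => f x == f x' | _, _ => false end.
Proof.
case: u v => [x|y] [x'|y'] neq_uv.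
- case: eqVneq => [eq_f|neq_f] /=.
    rewrite -(cards1 (inr (f x) : Gam)); apply: eq_card => -[z|z].
      by rewrite !inE /= !adjE /= !andbF.
    by rewrite !inE /= !adjE /= -eq_f andbb (inj_eq inr_inj) eq_sym.
  apply: eq_card0 => -[z|z]; rewrite !inE /= !adjE /= ?andbF //.
  by apply/negP=> /andP[/eqP<- /eqP eq_f]; rewrite eq_f eqxx in neq_f.
- by apply: eq_card0 => -[z|z]; rewrite !inE /= !adjE /= ?andbF.
- by apply: eq_card0 => -[z|z]; rewrite !inE /= !adjE /= ?andbF.
- apply: eq_card0 => -[z|z]; rewrite !inE /= !adjE /= ?andbF //.
  apply/negP=> /andP[/eqP eq_fy /eqP eq_fy'].
  by rewrite -eq_fy -eq_fy' eqxx in neq_uv.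
Qed.

Lemma perm_spectrum_CN :
  perm_eq (spectrum (common_neighborhood_mx Gam) ++ nseq l (-1))
          (nseq n (-1) ++ [seq 0 | y <- enum Y]
                       ++ [seq (d y)%:R - 1 | y <- enum Y]).
Proof.
apply: (@perm_spectrum_star_mx _ _ f (-1) 1 0 (fun=> 0)) => [|y|y].
- apply/matrixP=> i j; rewrite !mxE /= -(inj_eq enum_val_inj).
  case: (enum_val i) (enum_val j) => [x|y] [x'|y'] /=; first 1 last.
  - by rewrite mul0rn card_common_neighbors_star.
  - by rewrite mul0rn card_common_neighbors_star.
  - rewrite mul0rn; case: eqVneq => // neq_y.
    by rewrite card_common_neighbors_star.
  rewrite (inj_eq inl_inj); case: eqVneq => [->|neq_x].
    by rewrite eqxx addNr.
  by rewrite add0r card_common_neighbors_star ?(inj_eq inl_inj).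
- by rewrite /=; ring.
- by rewrite /=; ring.
Qed.

Lemma sum_fiber : (\sum_y d y = n)%N.
Proof.
rewrite -sum1_card (partition_big f xpredT) //=; apply: eq_bigr => y _.
by rewrite -sum1_card; apply: eq_bigl => x; rewrite inE.
Qed.

Lemma perm_spectrum_laplacian :
  perm_eq (spectrum (laplacian_mx Gam) ++ nseq l 1)
    (nseq n 1 ++ [seq 0 | y <- enum Y] ++ [seq (d y)%:R + 1 | y <- enum Y]).
Proof.
apply: (@perm_spectrum_degree_adjacency _ (-1)); first by rewrite sqrrN expr1n.
by rewrite scaleN1r.
Qed.

Lemma perm_spectrum_signless_laplacian :
  perm_eq (spectrum (signless_laplacian_mx Gam) ++ nseq l 1)
    (nseq n 1 ++ [seq 0 | y <- enum Y] ++ [seq (d y)%:R + 1 | y <- enum Y]).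
Proof.
apply: (@perm_spectrum_degree_adjacency _ 1); first by rewrite expr1n.
by rewrite scale1r.
Qed.

Lemma star_forest_L_integral : L_integral Gam.
Proof.
apply: (integral_mx_perm perm_spectrum_laplacian) => x; rewrite !mem_cat.
by case/or3P=> [/nseqP[->]|/mapP[y _ ->]|/mapP[y _ ->]];
  rewrite ?rpredD ?rpred0 ?rpred1 ?rpred_nat.
Qed.

Lemma star_forest_Q_integral : Q_integral Gam.
Proof.
apply: (integral_mx_perm perm_spectrum_signless_laplacian) => x.
rewrite !mem_cat.
by case/or3P=> [/nseqP[->]|/mapP[y _ ->]|/mapP[y _ ->]];
  rewrite ?rpredD ?rpred0 ?rpred1 ?rpred_nat.
Qed.

Lemma star_forest_CN_integral : CN_integral Gam.
Proof.
apply: (integral_mx_perm perm_spectrum_CN) => x; rewrite !mem_cat.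
by case/or3P=> [/nseqP[->]|/mapP[y _ ->]|/mapP[y _ ->]];
  rewrite ?rpredB ?rpredN ?rpred0 ?rpred1 ?rpred_nat.
Qed.

Lemma star_forest_not_integral y :
  (forall k : nat, d y != k ^ 2)%N -> ~ integral_graph Gam.
Proof.
move=> nsq_dy int_Gam; pose x : algC := sqrtC (d y)%:R.
have x_neq0 : x != 0 by rewrite sqrtC_eq0 pnatr_eq0 -(exp0n (isT : 0 < 2)%N).
have: x \in spectrum (adjacency_mx Gam) ++ nseq l 0.
  rewrite (perm_mem perm_spectrum_adjacency) !mem_cat.
  by rewrite (map_f (fun y => sqrtC (d y)%:R)) ?mem_enum ?orbT.
rewrite mem_cat => /orP[|/nseqP[x0]]; last by rewrite x0 eqxx in x_neq0.
rewrite -eigenvalue_spectrum => /int_Gam int_x.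
have /natrP[k xk] : x \is a Num.nat.
  by rewrite natrEint int_x sqrtC_ge0 ler0n.
have /eqP[] := nsq_dy k.
by apply/eqP; rewrite -(eqr_nat algC) natrX -xk sqrtCK.
Qed.

Lemma energy_star_forest : energy Gam = \sum_y 2 * sqrtC (d y)%:R.
Proof.
have := sum_spectrum_star (fun x => `|x|) perm_spectrum_adjacency.
rewrite normr0 !mul0rn addr0 add0r /energy => ->; apply: eq_bigr => y _.
by rewrite normrN ger0_norm ?sqrtC_ge0 ?ler0n // mulr_natl mulr2n.
Qed.

(** For m > 0 this is the nonnegativity of (sqrt m - 1)^2. *)
Lemma double_sqrtC_le (m : nat) : 2 * sqrtC m%:R <= m%:R + (0 < m)%N%:R :> algC.
Proof.
case: m => [|m]; first by rewrite sqrtC0 mulr0 addr0.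
have sq_ge0 : 0 <= (sqrtC m.+1%:R - 1) ^+ 2 :> algC.
  by rewrite real_exprn_even_ge0 // rpredB // ger0_real // sqrtC_ge0 ler0n.
by rewrite -subr_ge0; move: sq_ge0; rewrite sqrrB1 sqrtCK mulr_natl addrAC.
Qed.

Definition nb_empty : nat := #|[set y | d y == 0%N]|.

Lemma sum_nonempty_fibers : (\sum_y (0 < d y)%N + nb_empty = l)%N.
Proof.
rewrite /nb_empty -sum1_card [X in (_ + X)%N]big_mkcond -big_split /=.
rewrite -sum1_card.
by apply: eq_bigr => y _; rewrite inE; case: (d y).
Qed.

Lemma energy_star_forest_le : energy Gam + nb_empty%:R <= (n + l)%:R.
Proof.
rewrite -sum_fiber -sum_nonempty_fibers addnA -big_split /= natrD lerD2r.
rewrite natr_sum energy_star_forest; apply: ler_sum => y _.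
by rewrite natrD double_sqrtC_le.
Qed.

Lemma star_forest_hypoenergetic y : d y != 1%N -> hypoenergetic Gam.
Proof.
move=> dy_neq1; rewrite /hypoenergetic card_star_forest energy_star_forest.
have lt_y : 2 * sqrtC (d y)%:R < (d y + 1)%:R :> algC.
  have sq_gt0 : 0 < (sqrtC (d y)%:R - 1) ^+ 2 :> algC.
    rewrite real_exprn_even_gt0 ?rpredB ?ger0_real ?sqrtC_ge0 ?ler0n //=.
    apply: contraNneq dy_neq1 => /eqP; rewrite subr_eq0 => /eqP sqrt1.
    by rewrite -(eqr_nat algC) -[X in X == _]sqrtCK sqrt1 expr1n.
  rewrite -subr_gt0; move: sq_gt0.
  by rewrite sqrrB1 sqrtCK mulr_natl natrD addrAC.
rewrite -sum_fiber -[#|Y|]sum1_card -big_split /= natr_sum.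
rewrite (bigD1 y) //= [ltRHS](bigD1 y) //=.
apply: ltr_leD => //; apply: ler_sum => z _.
apply: le_trans (double_sqrtC_le _) _.
by rewrite natrD lerD2l ler_nat; case: (d z).
Qed.

(** The eigenvalues are integers and the average degree is 2 n / (n + l), so
    after scaling by n + l every deviation is an integer. For a nonempty
    fibre the eigenvalue d y + 1 is at least the average degree, while for an
    empty one it is 1, which lies below it when l < n: hence the term in the
    number of empty fibres. *)
Lemma sum_norm_sub_avg (s : seq algC) : (0 < n)%N ->
  perm_eq (s ++ nseq l 1)
    (nseq n 1 ++ [seq 0 | y <- enum Y] ++ [seq (d y)%:R + 1 | y <- enum Y]) ->
  (\sum_(x <- s) `|x - avg_degree Gam|) * (n + l)%:R
  = ((n + l)%:Z ^+ 2 + (n%:Z - l%:Z) * `|n%:Z - l%:Z|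
     + nb_empty%:Z * (`|n%:Z - l%:Z| + (n%:Z - l%:Z)))%:~R.
Proof.
move=> n_gt0 /sum_spectrum_star sumE.
pose g (x : algC) := `|x - avg_degree Gam| * (n + l)%:R.
pose G (z : int) : int := `|z * (n + l)%:Z - 2 * n%:Z|.
have gE z : g z%:~R = (G z)%:~R.
  rewrite /g /G /avg_degree num_edges_star_forest card_star_forest.
  rewrite -[X in _ * X]ger0_norm ?ler0n // -normrM mulrBl divfK; last first.
    by rewrite pnatr_eq0 -lt0n addn_gt0 n_gt0.
  by rewrite intr_norm rmorphB !rmorphM /= natrM.
have g1 := gE 1; have g0 := gE 0; rewrite /= in g1 g0.
have gd y : g ((d y)%:R + 1) = (G ((d y)%:Z + 1))%:~R.
  by rewrite -gE rmorphD.
have {}sumE := sumE g; rewrite -mulr_suml in sumE.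
apply/(addIr (g 1 *+ l)); have G1 : G 1 = `|n%:Z - l%:Z| by rewrite /G; lia.
rewrite sumE g1 G1.
(* The absolute value is made opaque, as simplification would unfold it. *)
have [w wE] : {w : int | w = `|n%:Z - l%:Z|} by eexists.
rewrite -wE.
have -> : \sum_y (g 0 + g ((d y)%:R + 1))
          = (\sum_y (G 0 + G ((d y)%:Z + 1)))%:~R.
  by rewrite rmorph_sum; apply: eq_bigr => y _; rewrite rmorphD /= g0 gd.
rewrite -!rmorphMn -!rmorphD /=; congr (_%:~R).
have {}gE y : G 0 + G ((d y)%:Z + 1)
    = (d y + 1)%:Z * (n + l)%:Z
      + (d y == 0%N)%:Z * (w + (n%:Z - l%:Z)).
  by rewrite wE /G; case: (d y) => [|m] /=; nia.
rewrite (eq_bigr _ (fun y _ => gE y)) big_split /= -!mulr_suml.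
have -> : \sum_y (d y + 1)%:Z = (n + l)%:Z.
  rewrite -sum_fiber -[#|Y|]sum1_card -big_split /= -[RHS]natz natr_sum.
  by apply: eq_bigr => y _; rewrite natz.
have -> : \sum_y (d y == 0%N)%:Z = nb_empty%:Z.
  rewrite /nb_empty -sum1_card [in RHS]big_mkcond -[RHS]natz natr_sum.
  by apply: eq_bigr => y _; rewrite inE; case: (d y).
rewrite -[w *+ n]mulr_natr -[w *+ l]mulr_natr.
by rewrite !natz PoszD; ring.
Qed.

Lemma CN_energy_star_forest_le : CN_energy Gam <= (2 * n)%:R.
Proof.
have := sum_spectrum_star (fun x => `|x|) perm_spectrum_CN.
rewrite normrN1 normr0 -/(CN_energy Gam) => sumE.
rewrite -(lerD2r l%:R) sumE mul2n -addnn natrD -addrA lerD2l -natrD.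
rewrite -sum_fiber -[#|Y|]sum1_card -big_split natr_sum; apply: ler_sum => y _.
rewrite add0r natrD; apply: le_trans (ler_normB _ _) _.
by rewrite normr1 normr_nat.
Qed.

End StarForest.

(** * Energy comparisons for star forests *)

Section StarForestConclusion.

Local Open Scope ring_scope.

Variables (X Y : finType) (f : X -> Y) (adj : rel (X + Y))
  (adj_sym : symmetric adj) (adj_irrefl : irreflexive adj).
Hypothesis adjE : adj =2 star_adj f.

Let Gam := SGraph adj_sym adj_irrefl.
Local Notation n := #|X|.
Local Notation l := #|Y|.
Local Notation k := (nb_empty f).

Lemma nb_empty_lt : (0 < n)%N -> (k < l)%N.
Proof.
move=> /card_gt0P[x _]; rewrite -(sum_nonempty_fibers f).
rewrite -[ltnLHS]add0n ltn_add2r.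
rewrite (bigD1 (f x)) //= [(0 < #|_|)%N](_ : _ = true) //.
by apply/card_gt0P; exists x; rewrite inE.
Qed.

Lemma nonempty_fibers_le : (l <= n + k)%N.
Proof.
rewrite -(sum_nonempty_fibers f) leq_add2r -(sum_fiber f).
by apply: leq_sum => y _; case: #|_|.
Qed.

(** The list s stands for the spectrum of either Laplacian. The lower bound uses
    that the energy is at most n + l - k, and that the l - k nonempty fibres
    number at most n. The upper bound uses that k < l. *)
Lemma deviation_bounds (s : seq algC) : (0 < n)%N ->
  perm_eq (s ++ nseq l 1)
    (nseq n 1 ++ [seq 0 | y <- enum Y]
              ++ [seq #|fiber f y|%:R + 1 | y <- enum Y]) ->
  energy Gam <= \sum_(x <- s) `|x - avg_degree Gam| <= (2 * (n + l).-1)%:R.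
Proof.
move=> n_gt0 /(sum_norm_sub_avg adj_sym adj_irrefl adjE n_gt0).
set D := \sum_(x <- s) _ => DE; have lt_kl := nb_empty_lt n_gt0.
have le_l := nonempty_fibers_le.
have nl_gt0 : 0 < (n + l)%:R :> algC by rewrite ltr0n addn_gt0 n_gt0.
rewrite -[_ <= D](ler_pM2r nl_gt0) -[D <= _](ler_pM2r nl_gt0) DE.
apply/andP; split; last first.
  rewrite -natrM -[_%:R]/(_%:Z%:~R) ler_int; nia.
have : energy Gam <= (n + l - k)%:R.
  rewrite natrB; last by lia.
  by rewrite lerBrDr; apply: energy_star_forest_le.
move=> /(ler_wpM2r (ltW nl_gt0)) /le_trans; apply.
rewrite -natrM -[_%:R]/(_%:Z%:~R) ler_int; nia.
Qed.

(** The hypothesis yields the irrational eigenvalue sqrt (d y) and, since 1 is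
    a square, the strict inequality 2 sqrt (d y) < d y + 1. It also forces at
    least two leaves, hence at least three vertices. *)
Theorem star_forest_spectral_properties (y : Y) :
  (forall j : nat, #|fiber f y| != j ^ 2)%N ->
  [/\ [/\ ~ integral_graph Gam, L_integral Gam, Q_integral Gam
        & CN_integral Gam],
      [/\ hypoenergetic Gam, ~ hyperenergetic Gam, ~ L_hyperenergetic Gam,
          ~ Q_hyperenergetic Gam & ~ CN_hyperenergetic Gam]
    & satisfies_E_LE Gam].
Proof.
move=> nsq.
have n_gt1 : (1 < n)%N.
  have : (1 < #|fiber f y|)%N.
    by have := nsq 0%N; have := nsq 1%N; case: #|_| => [|[|]].
  by move/leq_trans; apply; apply: max_card.
have n_gt0 := ltnW n_gt1.
have l_gt0 := leq_ltn_trans (leq0n _) (nb_empty_lt n_gt0).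
have cardE : #|Gam| = (n + l).-1.+1 by rewrite card_star_forest; lia.
have [E_LE LE_le] := andP (deviation_bounds n_gt0
  (perm_spectrum_laplacian adj_sym adj_irrefl adjE)).
have [_ QE_le] := andP (deviation_bounds n_gt0
  (perm_spectrum_signless_laplacian adj_sym adj_irrefl adjE)).
have CN_le := CN_energy_star_forest_le adj_sym adj_irrefl adjE.
have hypoE : hypoenergetic Gam.
  by apply: (star_forest_hypoenergetic _ _ adjE (y := y)); apply: (nsq 1%N).
split; last exact: E_LE.
- split; [exact: star_forest_not_integral nsq | exact: star_forest_L_integral
    | exact: star_forest_Q_integral | exact: star_forest_CN_integral].
- split=> //.
  + rewrite /hyperenergetic cardE energy_complete => lt_E.
    have := lt_trans lt_E hypoE; rewrite card_star_forest ltr_nat; lia.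
  + rewrite /L_hyperenergetic cardE L_energy_complete => /lt_geF.
    by rewrite LE_le.
  + rewrite /Q_hyperenergetic cardE Q_energy_complete => /lt_geF.
    by rewrite QE_le.
  + rewrite /CN_hyperenergetic cardE CN_energy_complete => /lt_le_trans.
    by move=> /(_ _ CN_le); rewrite ltr_nat; nia.
Qed.

End StarForestConclusion.

(** * The subgroup generating graph *)

Section SubgroupGeneratingGraph.

Variable gT : finGroupType.

Local Open Scope group_scope.

Definition generated_by_pair (u : gT * gT) : {group gT} :=
  <<[set u.1; u.2]>>%G.

Lemma sgb_adj_star : @sgb_adj gT =2 star_adj generated_by_pair.
Proof. by case=> [[a b]|H] [[c d]|K]. Qed.

(** A pair in H generates a subgroup of H, which is H itself or trivial as the
    order of H is prime. It is trivial only for the pair (1, 1). *)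
Lemma card_fiber_prime (H : {group gT}) :
  prime #|H| -> #|fiber generated_by_pair H| = (#|H| ^ 2 - 1)%N.
Proof.
move=> pr_H; have -> : fiber generated_by_pair H = setX H H :\ (1, 1).
  apply/setP=> [[a b]]; rewrite !inE xpair_eqE -val_eqE /=.
  apply/eqP/idP => [defH | /and3P[nt_ab Ha Hb]].
    rewrite -defH !mem_gen ?set21 ?set22 // !andbT; apply: contraL pr_H.
    rewrite -defH => /andP[/eqP-> /eqP->].
    by rewrite setUid -[<<_>>]/<[1]> cycle1 cards1.
  have sKH : <<[set a; b]>> \subset H by rewrite gen_subG subUset !sub1set Ha.
  apply/eqP; rewrite eqEsubset sKH; apply: contraR nt_ab => not_sHK.
  have := prime_TIg pr_H not_sHK; rewrite (setIidPr sKH) => K1.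
  by rewrite -!in_set1 -[[set 1]]K1 !mem_gen ?set21 ?set22.
by rewrite -mulnn -cardsX [#|setX _ _|](cardsD1 (1, 1)) inE /= !group1 addKn.
Qed.

Lemma nontrivial_of_Z2_quotient : [set: 'Z_2] \homg [set: gT] -> (1 < #|gT|)%N.
Proof.
by move/leq_homg; rewrite !cardsT card_ord.
Qed.

(** The elements 1 and b of a group of order 2 generate it and satisfy the
    relations; the same holds for the dicyclic presentation below. *)
Lemma dihedral_nontrivial m : is_dihedral m gT -> (1 < #|gT|)%N.
Proof.
move=> isoG; apply: nontrivial_of_Z2_quotient; rewrite isoG.
apply/existsP; exists (1, Zp1); rewrite /= !xpair_eqE /=.
by rewrite !expg1n eqEsubset subsetT Zp_cycle joing_subr.
Qed.

Lemma dicyclic_nontrivial m : is_dicyclic m gT -> (1 < #|gT|)%N.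
Proof.
move=> isoG; apply: nontrivial_of_Z2_quotient; rewrite isoG.
apply/existsP; exists (1, Zp1); rewrite /= !xpair_eqE /=.
by rewrite !expg1n eqEsubset subsetT Zp_cycle joing_subr.
Qed.

End SubgroupGeneratingGraph.

(** By Cauchy's theorem there is a subgroup of prime order q, generated by
    q^2 - 1 pairs, and (q - 1)^2 < q^2 - 1 < q^2. *)
Theorem nontrivial_group_spectral_properties (gT : finGroupType) :
  (1 < #|gT|)%N ->
  let B := subgroup_generating_graph gT in
  [/\ [/\ ~ integral_graph B, L_integral B, Q_integral B & CN_integral B],
      [/\ hypoenergetic B, ~ hyperenergetic B, ~ L_hyperenergetic B,
          ~ Q_hyperenergetic B & ~ CN_hyperenergetic B]
    & satisfies_E_LE B].
Proof.
move=> nt_G; have [x _ ox] := Cauchy (pdiv_prime nt_G)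
  (etrans (congr1 _ (cardsT gT)) (pdiv_dvd _)).
have pr_x : prime #|<[x]>%G| by rewrite [#|_|]ox pdiv_prime.
apply: (star_forest_spectral_properties _ _ (@sgb_adj_star gT) (y := <[x]>%G)).
move=> j; rewrite card_fiber_prime //; have := prime_gt1 pr_x.
move: #|_| => q q_gt1; rewrite -!mulnn; apply/eqP => eq_qj.
(* If j < q then (j + 1)^2 <= q^2 = j^2 + 1, whence j = 0 and q = 1. *)
by case: (ltnP j q) => le_jq; have := leq_mul le_jq le_jq; nia.
Qed.

Theorem mainTheorem16 (p : nat) (gT : finGroupType) :
  prime p ->
  [\/ is_dihedral p gT, is_dihedral (p ^ 2) gT,
      is_dicyclic p gT | is_dicyclic (p ^ 2) gT] ->
  let B := subgroup_generating_graph gT in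
  [/\ [/\ ~ integral_graph B, L_integral B, Q_integral B & CN_integral B],
      [/\ hypoenergetic B, ~ hyperenergetic B, ~ L_hyperenergetic B,
          ~ Q_hyperenergetic B & ~ CN_hyperenergetic B]
    & satisfies_E_LE B].
Proof.
move=> _ isoG; apply: nontrivial_group_spectral_properties.
by case: isoG => [/dihedral_nontrivial | /dihedral_nontrivial
  | /dicyclic_nontrivial | /dicyclic_nontrivial].
Qed.
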